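(* There exists a deterministic algorithm that, given a tournament $G$ on $n$ vertices and a weight function $w : V(G)\to\mathbb{N}$, runs in time $n^{O(\log n)}$ and outputs a $2$-approximate solution of $(G,w)$, i.e. a feedback vertex set $S$ of $G$ with $w(S) \le 2\,w(S_{OPT})$, where $S_{OPT}$ is a minimum-weight feedback vertex set of $G$.
   Context: A tournament is a directed graph without loops or parallel arcs in which every pair of distinct vertices is joined by exactly one arc. A feedback vertex set (FVS) of a digraph $G$ is a set $S \subseteq V(G)$ such that $G - S$ contains no directed cycle. For $S\subseteq V(G)$, $w(S)=\sum_{v\in S} w(v)$. An optimal solution of $(G,w)$ is an FVS of minimum weight. *)

(* Defs.v *)
From mathcomp Require Import all_boot.

Set Implicit Arguments.
Unset Strict Implicit.
Unset Printing Implicit Defensive.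

(* A digraph on a finite vertex type V is a relation G : rel V; this rules    *)
(* out parallel arcs.                                                         *)
Definition tournament (V : finType) (G : rel V) : Prop :=
  irreflexive G /\ forall x y : V, x != y -> G x y (+) G y x.

(* The vertices of S are kept, as isolated vertices: this does not affect the *)
(* directed cycles.                                                           *)
Definition del_vertices (V : finType) (G : rel V) (S : {set V}) : rel V :=
  fun x y => [&& x \notin S, y \notin S & G x y].

Definition acyclic (V : finType) (G : rel V) : Prop :=
  forall c : seq V, c != [::] -> ~ ucycle G c.

Definition is_fvs (V : finType) (G : rel V) (S : {set V}) : Prop :=
  acyclic (del_vertices G S).

Definition weight (V : finType) (w : V -> nat) (S : {set V}) : nat :=
  \sum_(v in S) w v.

Definition optimal_fvs (V : finType) (G : rel V) (w : V -> nat)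
    (S : {set V}) : Prop :=
  is_fvs G S /\ forall S' : {set V}, is_fvs G S' -> weight w S <= weight w S'.

Definition two_approx_fvs (V : finType) (G : rel V) (w : V -> nat)
    (S : {set V}) : Prop :=
  is_fvs G S /\
  forall Sopt : {set V}, optimal_fvs G w Sopt -> weight w S <= 2 * weight w Sopt.

(* Model of computation: first-order call-by-value functional programs, with  *)
(* recursion, over natural numbers and pairs.  Every evaluation step has unit *)
(* cost.  The only arithmetic is addition and truncated subtraction, and the  *)
(* only test is against the number 0.  Representing pairs by pointers, each   *)
(* step takes a number of operations of a unit-cost RAM with addition and     *)
(* subtraction that depends on the program only; conversely such a RAM is     *)
(* simulated with polynomial overhead.                                        *)
Inductive value : Type :=
| VNum of nat
| VPair of value & value.

(* Var i is a de Bruijn index.  Let e1 e2 binds the value of e1 to index 0    *)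
(* in e2.  If e e1 e2 selects e2 exactly when e has value VNum 0.  Call f e   *)
(* evaluates the body of the f-th function of the program, in which the only  *)
(* bound variable is the value of e, with index 0.                            *)
Inductive expr : Type :=
| Var of nat
| Const of nat
| Add of expr & expr
| Sub of expr & expr
| Pair of expr & expr
| Fst of expr
| Snd of expr
| If of expr & expr & expr
| Let of expr & expr
| Call of nat & expr.

Definition program : Type := seq expr.

(* eval P env e v t: in the environment env, e evaluates to v in t steps.     *)
(* Ill-typed operations and unbound indices are stuck: they have no value.    *)
Inductive eval (P : program) : seq value -> expr -> value -> nat -> Prop :=
| EvVar env i v :
    onth env i = Some v -> eval P env (Var i) v 1
| EvConst env k :
    eval P env (Const k) (VNum k) 1
| EvAdd env e1 e2 a b t1 t2 :
    eval P env e1 (VNum a) t1 -> eval P env e2 (VNum b) t2 ->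
    eval P env (Add e1 e2) (VNum (a + b)) (t1 + t2).+1
| EvSub env e1 e2 a b t1 t2 :
    eval P env e1 (VNum a) t1 -> eval P env e2 (VNum b) t2 ->
    eval P env (Sub e1 e2) (VNum (a - b)) (t1 + t2).+1
| EvPair env e1 e2 v1 v2 t1 t2 :
    eval P env e1 v1 t1 -> eval P env e2 v2 t2 ->
    eval P env (Pair e1 e2) (VPair v1 v2) (t1 + t2).+1
| EvFst env e v1 v2 t :
    eval P env e (VPair v1 v2) t -> eval P env (Fst e) v1 t.+1
| EvSnd env e v1 v2 t :
    eval P env e (VPair v1 v2) t -> eval P env (Snd e) v2 t.+1
| EvIfTrue env e e1 e2 u v t t' :
    eval P env e u t -> u <> VNum 0 -> eval P env e1 v t' ->
    eval P env (If e e1 e2) v (t + t').+1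
| EvIfFalse env e e1 e2 v t t' :
    eval P env e (VNum 0) t -> eval P env e2 v t' ->
    eval P env (If e e1 e2) v (t + t').+1
| EvLet env e1 e2 u v t t' :
    eval P env e1 u t -> eval P (u :: env) e2 v t' ->
    eval P env (Let e1 e2) v (t + t').+1
| EvCall env f e body u v t t' :
    eval P env e u t -> onth P f = Some body -> eval P [:: u] body v t' ->
    eval P env (Call f e) v (t + t').+1.

Lemma eval_deterministic (P : program) env e v t v' t' :
  eval P env e v t -> eval P env e v' t' -> v = v' /\ t = t'.
Proof.
move=> ev; elim: ev v' t' => {env e v t} *;
  repeat match goal with
  | IH : (forall v t, eval _ ?env ?e v t -> _), H : eval _ ?env ?e _ _ |- _ =>
      clear H
  end;
  match goal with H : eval _ _ _ _ _ |- _ = _ /\ _ => inversion H; subst end;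
  repeat match goal with
  | IH : (forall v t, eval _ ?env ?e v t -> _), H : eval _ ?env ?e _ _ |- _ =>
      let E := fresh "E" in
      destruct (IH _ _ H) as [E ?]; clear IH H; try (injection E; intros); subst
  | H1 : onth _ ?f = Some _, H2 : onth _ ?f = Some _ |- _ =>
      rewrite H1 in H2; injection H2; intros; clear H2; subst
  end;
  split; congruence.
Qed.

(* The main function is the one of index 0.                                   *)
Definition runs (P : program) (input output : value) (t : nat) : Prop :=
  eval P [:: input] (Call 0 (Var 0)) output t.

(* Lists are nested pairs terminated by VNum 0.                               *)
Definition encode_seq (s : seq value) : value := foldr VPair (VNum 0) s.

(* A weighted digraph on the vertices 0, ..., n-1 is given by its adjacency   *)
(* matrix, row by row, and the list of its weights.                           *)
Definition encode_instance (n : nat) (G : rel 'I_n) (w : 'I_n -> nat) : value :=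
  VPair
    (encode_seq [seq encode_seq [seq VNum (G x y : bool) | y <- enum 'I_n]
                | x <- enum 'I_n])
    (encode_seq [seq VNum (w x) | x <- enum 'I_n]).

(* A set of vertices is given by its characteristic 0/1 vector.               *)
Definition encode_set (n : nat) (S : {set 'I_n}) : value :=
  encode_seq [seq VNum (x \in S) | x <- enum 'I_n].

(* T n = n^{O(log n)}.  For n >= 2, trunc_log 2 n is within a factor 2 of the *)
(* real base-2 logarithm.                                                     *)
Definition n_pow_O_log (T : nat -> nat) : Prop :=
  exists c n0 : nat, forall n, n0 <= n -> T n <= n ^ (c * trunc_log 2 n).

(* Main.v *)
(** Local ratio on directed triangles. If p is a vertex outside a feedback
    vertex set S, then S hits every arc x -> y with x in N+(p) and y in N-(p),
    so lowering both weights by min (w x) (w y) for each such arc costs at most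
    twice what S loses. Deleting the vertices of weight 0 then leaves no cycle
    through both N-(p) and N+(p), and these two parts are solved separately.
    If S contains at least half of the vertices, lowering all weights by
    their minimum is a 2-approximate step as well. Otherwise the median of the
    transitive tournament on the complement of S is a pivot p whose two sides
    have at most 3/4 of the vertices. S being unknown, the algorithm tries the
    uniform step, which removes a vertex, and all pivots with balanced sides;
    this gives T(m) <= T(m - 1) + 2 m T(3 m / 4) + poly(m).

    Solutions are represented by the vertices that are kept, in an order without
    backward arcs, each with its reduced weight at the time it was a pivot. The
    sum of these weights is a lower bound on the kept weight and is the value
    that candidates are compared by: the guarantee proved for it is
    w(V) <= value + 2 w(S) for all S. *)

Require Import Defs.
From mathcomp Require Import all_boot zify.
Import Defs.

Set Implicit Arguments.
Unset Strict Implicit.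
Unset Printing Implicit Defensive.

(** * Local ratio steps *)

Section LocalRatio.
Variables (V : finType) (G : rel V).
Notation item := (V * nat)%type.
Implicit Types (x y p : item) (s u K : seq item) (S : {set V}).

Definition total_weight s := \sum_(x <- s) x.2.

Definition cost S s := \sum_(x <- s | x.1 \in S) x.2.

(** Kept vertices carry weights already reduced by earlier steps, so membership is relaxed to
    domination: same vertex, weight no larger. *)
Definition below s u :=
  forall x, x \in s -> exists2 y, y \in u & x.1 = y.1 /\ x.2 <= y.2.

(** Dropping an item puts its vertex into the feedback vertex set, which is free at weight 0. *)
Definition nz s : seq item := [seq x <- s | x.2 != 0].

(* The truncated differences lower both weights by their minimum. *)
Fixpoint relax x s : item * seq item :=
  if s is y :: s' then
    if G x.1 y.1 then
      let r := relax (x.1, x.2 - y.2) s' in (r.1, (y.1, y.2 - x.2) :: r.2)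
    else let r := relax x s' in (r.1, y :: r.2)
  else (x, [::]).

(** Meant for [s] the out-neighbours and [u] the in-neighbours of a pivot: each arc from [s] to [u]
    then closes a triangle through the pivot. *)
Fixpoint cross s u : seq item * seq item :=
  if s is x :: s' then
    let r := relax x u in let q := cross s' r.2 in (r.1 :: q.1, q.2)
  else ([::], u).

Definition inn p s : seq item := [seq x <- s | G x.1 p.1].
Definition outn p s : seq item := [seq x <- s | G p.1 x.1].

Definition lower m s : seq item := [seq (x.1, x.2 - m) | x <- s].

Definition minw m s := foldl (fun a x => minn a x.2) m s.

Definition hits_triangles S :=
  forall a b c : V, G a b -> G b c -> G c a -> [|| a \in S, b \in S | c \in S].

(** The list is its own topological order, hence a certificate that deleting all other vertices
    leaves no cycle. *)
Definition forward K :=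
  uniq (unzip1 K) && pairwise (fun x y => ~~ G y.1 x.1) K.

Definition covers s K S := total_weight s <= total_weight K + 2 * cost S s.

(** Domination by [nz s] rather than [s] forces the kept vertices to have positive weight; this is
    what excludes arcs from one side of a pivot back to the other. *)
Definition solution s K :=
  [/\ forward K, below K (nz s)
    & forall S, hits_triangles S -> covers s K S].

Definition balanced p s :=
  (4 * size (inn p s) <= 3 * size s) && (4 * size (outn p s) <= 3 * size s).

Lemma total_weight_cons x s : total_weight (x :: s) = x.2 + total_weight s.
Proof. by rewrite /total_weight big_cons. Qed.

Lemma total_weight_cat s u : total_weight (s ++ u) = total_weight s + total_weight u.
Proof. by rewrite /total_weight big_cat. Qed.

Lemma cost_cons S x s : cost S (x :: s) = (x.1 \in S) * x.2 + cost S s.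
Proof. by rewrite /cost big_cons; case: ifP; rewrite ?mul1n. Qed.

Lemma total_weight_nz s : total_weight (nz s) = total_weight s.
Proof.
elim: s => //= x s IH; case: eqP => /= E; rewrite !total_weight_cons IH //.
by rewrite E.
Qed.

Lemma cost_nz S s : cost S (nz s) = cost S s.
Proof.
elim: s => //= x s IH; case: eqP => /= E; rewrite !cost_cons IH //.
by rewrite E muln0.
Qed.

Lemma nz_id s : nz (nz s) = nz s.
Proof. by rewrite /nz filter_id. Qed.

Lemma below_refl s : below s s.
Proof. by move=> x xs; exists x. Qed.

Lemma below_trans u s t : below s u -> below u t -> below s t.
Proof.
move=> su ut x /su[y /ut[z zt [yz1 yz2]] [xy1 xy2]].
by exists z => //; split; [rewrite xy1 | apply: leq_trans yz2].
Qed.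

Lemma sub_below s u : {subset s <= u} -> below s u.
Proof. by move=> su x /su xu; exists x. Qed.

Lemma below_cons x y s u :
  x.1 = y.1 -> x.2 <= y.2 -> below s u -> below (x :: s) (y :: u).
Proof.
move=> e1 e2 su z; rewrite inE => /orP[/eqP->|/su[t tu et]].
  by exists y; rewrite ?mem_head.
by exists t; rewrite // inE tu orbT.
Qed.

Lemma below_nz s u : below s u -> below (nz s) (nz u).
Proof.
move=> su x; rewrite mem_filter => /andP[x0 /su[y yu [e1 e2]]].
by exists y => //; rewrite mem_filter yu andbT -lt0n (leq_trans _ e2) // lt0n.
Qed.

Lemma nz_sub s : {subset nz s <= s}.
Proof. by move=> x; rewrite mem_filter => /andP[]. Qed.

(** * Lowering weights along arcs *)

(** Both differences use the weights before the step, so one of them vanishes; the weight of [x] can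
    only decrease afterwards, so a zero persists. *)
Lemma relax_spec x s :
  let r := relax x s in
  [/\ r.1.1 = x.1, r.1.2 <= x.2, unzip1 r.2 = unzip1 s, below r.2 s
    & forall y, y \in r.2 -> G x.1 y.1 -> (r.1.2 == 0) || (y.2 == 0)].
Proof.
elim: s x => [|y s IH] x /=; first by split.
case: ifP => xy /=.
- have [/= e1 e2 e3 e4 e5] := IH (x.1, x.2 - y.2).
  split=> //; [by lia | by rewrite e3 | by apply: below_cons => //=; lia |].
  move=> z; rewrite inE => /orP[/eqP-> /= _|]; [lia|exact: e5].
- have [/= e1 e2 e3 e4 e5] := IH x.
  split=> //; [by rewrite e3 | by apply: below_cons |].
  move=> z; rewrite inE => /orP[/eqP->|]; [by rewrite xy|exact: e5].
Qed.

(** A step of amount [m] lowers the total by [2 * m] and, as [S] contains an endpoint of the arc,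
    the cost by at least [m]. Hence total minus twice the cost never decreases. *)
Lemma relax_total S x s :
  (forall y, y \in s -> G x.1 y.1 -> (x.1 \in S) || (y.1 \in S)) ->
  let r := relax x s in
  total_weight (x :: s) + 2 * cost S (r.1 :: r.2)
    <= total_weight (r.1 :: r.2) + 2 * cost S (x :: s).
Proof.
elim: s x => [|y s IH] x hS /=; first by rewrite addnC.
case: ifP => xy /=; rewrite /= !total_weight_cons !cost_cons /=.
- have := IH (x.1, x.2 - y.2) (fun z zs => hS z (@mem_behead _ (y :: s) z zs)).
  rewrite /= !total_weight_cons !cost_cons /=.
  have [/= e _ _ _ _] := relax_spec (x.1, x.2 - y.2) s; rewrite e.
  have := hS y (mem_head _ _) xy.
  by case: (x.1 \in S); case: (y.1 \in S) => //= _; rewrite ?mul1n ?mul0n; lia.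
- have := IH x (fun z zs => hS z (@mem_behead _ (y :: s) z zs)).
  by rewrite /= !total_weight_cons !cost_cons /=; lia.
Qed.

Lemma cross_spec s u :
  let c := cross s u in
  [/\ unzip1 c.1 = unzip1 s, unzip1 c.2 = unzip1 u, below c.1 s, below c.2 u
    & forall x y, x \in c.1 -> y \in c.2 -> G x.1 y.1 -> (x.2 == 0) || (y.2 == 0)].
Proof.
elim: s u => [|x s IH] u /=; first by split => //; exact: below_refl.
have [r1 r2 r3 r4 r5] := relax_spec x u.
have [/= c1 c2 c3 c4 c5] := IH (relax x u).2.
split; rewrite ?c1 ?c2 ?r1 //; first exact: below_cons.
  exact: below_trans r4.
(* A weight of [u] that became 0 while relaxing [x] stays 0, since the later rounds only lower
   weights. *)
move=> z y; rewrite inE => /orP[/eqP-> yc|]; last exact: c5.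
have [y' y'r [e1 e2]] := c4 _ yc.
by rewrite r1 e1 => /(r5 _ y'r)/orP[->//|/eqP e]; rewrite -!leqn0 -e e2 orbT.
Qed.

Lemma cross_total S s u :
  (forall x y, x \in s -> y \in u -> G x.1 y.1 -> (x.1 \in S) || (y.1 \in S)) ->
  let c := cross s u in
  total_weight s + total_weight u + 2 * (cost S c.1 + cost S c.2)
    <= total_weight c.1 + total_weight c.2 + 2 * (cost S s + cost S u).
Proof.
elim: s u => [|x s IH] u hS /=; first by rewrite addnC.
have [r1 r2 r3 r4 r5] := relax_spec x u.
have /= := @relax_total S x u (fun y yu => hS x y (mem_head _ _) yu).
have /IH : forall z y, z \in s -> y \in (relax x u).2 -> G z.1 y.1 ->
    (z.1 \in S) || (y.1 \in S).
  move=> z y zs /r4[y' y'u [e _]]; rewrite e; apply: hS => //.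
  by rewrite inE zs orbT.
rewrite /= !total_weight_cons !cost_cons r1; lia.
Qed.

Lemma solution_nz s K : solution (nz s) K -> solution s K.
Proof.
case=> fK bK cK; split; rewrite ?nz_id // in bK *.
by move=> S /cK; rewrite /covers total_weight_nz cost_nz.
Qed.

Lemma solution_nil s : nz s = [::] -> solution s [::].
Proof.
move=> s0; apply: solution_nz; rewrite s0; split=> // S _.
by rewrite /covers /total_weight big_nil.
Qed.

(** * The uniform step *)

Lemma minw_le m s : minw m s <= m /\ forall x, x \in s -> minw m s <= x.2.
Proof.
elim: s m => [|y s IH] m /=; first by split.
have [h1 h2] := IH (minn m y.2); split; first by rewrite (leq_trans h1) ?geq_minl.
move=> x; rewrite inE => /orP[/eqP->|/h2//].
by rewrite (leq_trans h1) ?geq_minr.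
Qed.

Lemma minw_mem m s : minw m s = m \/ exists2 x, x \in s & minw m s = x.2.
Proof.
elim: s m => [|y s IH] m /=; first by left.
case: (IH (minn m y.2)) => [|[x xs]]; last by right; exists x; rewrite // inE xs orbT.
rewrite /minw => ->; case: leqP => _; [by left|].
by right; exists y; rewrite ?mem_head.
Qed.

Lemma total_weight_lower m s :
  (forall x, x \in s -> m <= x.2) ->
  total_weight s = total_weight (lower m s) + m * size s.
Proof.
elim: s => [|x s IH] hm; first by rewrite /total_weight !big_nil muln0.
rewrite /= !total_weight_cons IH /=; last by move=> y ys; apply: hm; rewrite inE ys orbT.
by have := hm x (mem_head _ _); lia.
Qed.

Lemma cost_lower S m s :
  (forall x, x \in s -> m <= x.2) ->
  cost S s = cost S (lower m s) + m * count (fun x => x.1 \in S) s.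
Proof.
elim: s => [|x s IH] hm; first by rewrite /cost !big_nil muln0.
rewrite /= !cost_cons IH /=; last by move=> y ys; apply: hm; rewrite inE ys orbT.
by have := hm x (mem_head _ _); case: (x.1 \in S); lia.
Qed.

Lemma below_lower m s : below (lower m s) s.
Proof. by move=> _ /mapP[x xs ->]; exists x => //=; split=> //; lia. Qed.

(** The total drops by [m * size s], and twice the cost drops by at least as much because [S]
    contains half of the items. *)
Lemma lower_covers S m s K :
  (forall x, x \in s -> m <= x.2) ->
  size s <= 2 * count (fun x => x.1 \in S) s ->
  covers (lower m s) K S -> covers s K S.
Proof.
move=> hm hS; rewrite /covers (total_weight_lower hm) (cost_lower S hm).
by nia.
Qed.

(** Progress of the uniform step: the item attaining the minimum disappears. *)
Lemma nz_lower_lt m s :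
  (exists2 x, x \in s & m = x.2) -> size (nz (lower m s)) < size s.
Proof.
case=> x xs ->; rewrite size_filter -(size_map (fun y => (y.1, y.2 - x.2)) s).
rewrite ltn_neqAle count_size andbT -all_count; apply/allPn.
exists (x.1, x.2 - x.2); last by rewrite subnn.
by apply/mapP; exists x.
Qed.

(** * Pivots in a tournament *)

Hypothesis Gt : tournament G.

Lemma tour_irr v : G v v = false.
Proof. by case: Gt => + _; apply. Qed.

Lemma tour_asym v w : G v w -> G w v = false.
Proof.
case: Gt => irr tot vw; have vDw : v != w by apply: contraL vw => /eqP->; rewrite irr.
by have := tot _ _ vDw; rewrite vw /= => /negbTE.
Qed.

Lemma tour_total v w : [|| v == w, G v w | G w v].
Proof.
by case: eqP => //= /eqP /(Gt.2 _ _); case: (G v w).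
Qed.

(** Every vertex other than the pivot is an in-neighbour or an out-neighbour, never both. A general
    [F] serves both total weight and cost. *)
Lemma sum_split (F : item -> nat) p u :
  uniq (unzip1 u) -> p \in u ->
  \sum_(x <- u) F x
    = F p + \sum_(x <- inn p u) F x + \sum_(x <- outn p u) F x.
Proof.
have notin s : p.1 \notin unzip1 s ->
    \sum_(x <- s) F x = \sum_(x <- inn p s) F x + \sum_(x <- outn p s) F x.
  elim: s => [|x s IH] /=; first by rewrite !big_nil.
  rewrite inE negb_or => /andP[px /IH e]; rewrite big_cons e.
  have := tour_total p.1 x.1; rewrite (negbTE px) /=.
  by case/orP=> h; rewrite h (tour_asym h) !big_cons; lia.
elim: u => [|x s IH] //= /andP[xs us]; rewrite inE => /orP[/eqP epx|ps].
  by rewrite epx tour_irr big_cons notin -?epx ?addnA // epx.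
have px : p.1 != x.1 by apply: contraNneq xs => <-; apply: map_f.
have := tour_total p.1 x.1; rewrite (negbTE px) /= big_cons (IH us ps).
by case/orP=> h; rewrite h (tour_asym h) !big_cons; lia.
Qed.

(** As [S] avoids [p], it hits each arc from the out-side to the in-side, so [cross_total] applies;
    the two recursive guarantees add up, and [p] counts fully in the kept value and not in the cost
    of [S]. *)
Lemma pivot_covers S p u K1 K2 :
  uniq (unzip1 u) -> p \in u -> hits_triangles S -> p.1 \notin S ->
  let c := cross (outn p u) (inn p u) in
  solution c.2 K1 -> solution c.1 K2 -> covers u (K1 ++ p :: K2) S.
Proof.
move=> uu pu hS pS /= [_ _ /(_ S hS) h1] [_ _ /(_ S hS) h2].
have /cross_total /= : forall x y, x \in outn p u -> y \in inn p u ->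
    G x.1 y.1 -> (x.1 \in S) || (y.1 \in S).
  move=> x y; rewrite !mem_filter => /andP[px _] /andP[yp _] xy.
  by have := hS _ _ _ px xy yp; rewrite (negbTE pS).
rewrite /covers in h1 h2 *.
have tu : total_weight u = p.2 + total_weight (inn p u) + total_weight (outn p u).
  exact: sum_split.
have cu : cost S u = cost S (inn p u) + cost S (outn p u).
  by rewrite /cost !(big_mkcond (fun x => x.1 \in S)) (sum_split _ uu pu) (negbTE pS).
by rewrite total_weight_cat total_weight_cons tu cu /=; lia.
Qed.

(** [K1] lies in the in-neighbourhood and [K2] in the out-neighbourhood of [p], so only arcs from
    [K2] to [K1] could go backward. *)
Lemma pivot_forward p u K1 K2 :
  p \in u ->
  let c := cross (outn p u) (inn p u) in
  solution c.2 K1 -> solution c.1 K2 ->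
  forward (K1 ++ p :: K2) /\ below (K1 ++ p :: K2) u.
Proof.
move=> pu /= [/andP[u1 f1] b1 _] [/andP[u2 f2] b2 _].
have [_ _ bo bi hc] := cross_spec (outn p u) (inn p u).
have in1 x : x \in K1 -> G x.1 p.1.
  case/b1=> y /nz_sub/bi[z]; rewrite mem_filter => /andP[zp _].
  by case=> e _ [-> _]; rewrite e.
have in2 x : x \in K2 -> G p.1 x.1.
  case/b2=> y /nz_sub/bo[z]; rewrite mem_filter => /andP[zp _].
  by case=> e _ [-> _]; rewrite e.
split.
  rewrite /forward /unzip1 map_cat cat_uniq u1 /= u2 negb_or /= andbT.
  rewrite pairwise_cat /= f1 f2 /= !andbT -!andbA; apply/and5P; split.
  - by apply/mapP=> -[x /in1 + e]; rewrite -e tour_irr.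
  - apply/hasPn=> v /mapP[x /in2 x2 ->]; apply/mapP=> -[y /in1 + e].
    by rewrite -e (tour_asym x2).
  - by apply/mapP=> -[x /in2 + e]; rewrite -e tour_irr.
  - apply/allrelP=> x y xK; rewrite inE => /orP[/eqP->|yK].
      by rewrite (tour_asym (in1 _ xK)).
    (* After crossing, such an arc has an endpoint of weight 0, but both endpoints were kept with
       positive weight. *)
    apply/negP=> yx.
    have [x' + [ex _]] := b1 _ xK; have [y' + [ey _]] := b2 _ yK.
    rewrite !mem_filter => /andP[y0 yc] /andP[x0 xc].
    by have := hc _ _ yc xc; rewrite -ex -ey (negbTE x0) (negbTE y0) => /(_ yx).
  - by apply/allP=> x /in2 px; rewrite (tour_asym px).
move=> x; rewrite mem_cat inE => /or3P[xK|/eqP->|xK]; last 2 first.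
- by exists p.
- suff: below K2 u by apply.
  apply: (below_trans (below_trans b2 (below_nz bo))); apply: sub_below => y.
  by move/nz_sub; rewrite mem_filter => /andP[].
suff: below K1 u by apply.
apply: (below_trans (below_trans b1 (below_nz bi))); apply: sub_below => y.
by move/nz_sub; rewrite mem_filter => /andP[].
Qed.

(** Outside [S] there are no triangles, so these vertices are linearly ordered by the arcs. At least
    a quarter of [u] lies on either side of their median, counting the median itself, and is
    excluded from the opposite neighbourhood. *)
Lemma balanced_pivot S u :
  uniq (unzip1 u) -> hits_triangles S ->
  2 * count (fun x => x.1 \in S) u < size u ->
  exists p, [/\ p \in u, p.1 \notin S & balanced p u].
Proof.
move=> uu hS hc.
pose r := [seq x <- u | x.1 \notin S].
have sr : size r + count (fun x => x.1 \in S) u = size u.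
  by rewrite size_filter addnC -(count_predC (fun x : item => x.1 \in S) u).
pose le x y := (x.1 == y.1) || G x.1 y.1.
have le_tot : total le.
  by move=> x y; rewrite /le (eq_sym y.1); have := tour_total x.1 y.1; case: eqP.
have memr x : x \in r -> (x.1 \notin S) && (x \in u) by rewrite mem_filter.
have le_tr : {in r & &, transitive le}.
  move=> y x z /memr/andP[yS _] /memr/andP[xS _] /memr/andP[zS _].
  rewrite /le => /predU1P[->//|xy] /predU1P[<-|yz]; first by rewrite xy orbT.
  have := tour_total x.1 z.1; case/or3P=> [->//|->|zx]; first by rewrite orbT.
  by have := hS _ _ _ xy yz zx; rewrite (negbTE xS) (negbTE yS) (negbTE zS).
pose t := sort le r.
have memt x : (x \in t) = (x \in r) by rewrite mem_sort.
have st : size t = size r by rewrite size_sort.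
have ut : uniq (unzip1 t).
  rewrite (perm_uniq (perm_map _ (permEl (perm_sort le r)))).
  apply: subseq_uniq uu; exact/map_subseq/filter_subseq.
have lt_t : pairwise le t.
  rewrite -(@sorted_pairwise_in _ (mem r)) ?sort_sorted //.
  by apply/allP=> x; rewrite memt.
have r0 : 0 < size r by lia.
have [p0 _] : exists p, p \in t.
  by case: (t) st => [|p t'] /= e; [lia|exists p; rewrite mem_head].
(* The lower median: both [k.+1] and [size r - k] are at least half of [size r]. *)
pose k := (size r).-1./2.
have kt : k < size t by rewrite st /k; lia.
pose p := nth p0 t k.
have et : t = take k t ++ p :: drop k.+1 t by rewrite -drop_nth // cat_take_drop.
have pr : p \in r by rewrite -memt mem_nth.
have /andP[pS pu] := memr _ pr.
exists p; split=> //.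
have bound (a : pred item) (q : seq item) : uniq q -> {subset q <= r} ->
    (forall x, x \in q -> ~~ a x) -> size [seq x <- u | a x] + size q <= size u.
  move=> uq qr qa; rewrite -(count_predC a u) size_filter leq_add2l -size_filter.
  apply: uniq_leq_size => // x xq; rewrite mem_filter /= qa //.
  by have /memr/andP[] := qr _ xq.
have uqt : uniq t := map_uniq ut.
move: lt_t ut uqt; rewrite {1 2 3}et /unzip1 map_cat !cat_uniq pairwise_cat /=.
case/and3P=> /allrelP tp _ /andP[/allP pd _] /and3P[_ + /andP[+ _]].
rewrite negb_or => /andP[pnt _] pnd /and3P[u1 _ /andP[_ u2]].
have sub1 : {subset take k t <= r} by move=> x /mem_take; rewrite memt.
have sub2 : {subset drop k.+1 t <= r} by move=> x /mem_drop; rewrite memt.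
have ltp x : x \in take k t -> G x.1 p.1.
  move=> xt; have /orP[/eqP e|//] := tp x p xt (mem_head _ _).
  by case/negP: pnt; rewrite -e; apply: map_f.
have gtp x : x \in drop k.+1 t -> G p.1 x.1.
  move=> xt; have /orP[/eqP e|//] := pd _ xt.
  by case/negP: pnd; rewrite e; apply: map_f.
have /(_ _ _)/= in_le := bound (fun x => G x.1 p.1) (p :: drop k.+1 t).
have /(_ _ _)/= out_le := bound (fun x => G p.1 x.1) (p :: take k t).
have {in_le} : size (inn p u) + (size t - k.+1).+1 <= size u.
  rewrite -size_drop; apply: in_le.
  - by rewrite u2 andbT; apply: contra pnd; apply: map_f.
  - by move=> x; rewrite inE => /predU1P[->|/sub2].
  - move=> x; rewrite inE => /predU1P[->|/gtp/tour_asym->//].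
    by rewrite tour_irr.
have {out_le} : size (outn p u) + k.+1 <= size u.
  rewrite -{1}(size_takel (ltnW kt)); apply: out_le.
  - by rewrite u1 andbT; apply: contra pnt; apply: map_f.
  - by move=> x; rewrite inE => /predU1P[->|/sub1].
  - move=> x; rewrite inE => /predU1P[->|/ltp/tour_asym->//].
    by rewrite tour_irr.
rewrite st /balanced => h1 h2; apply/andP; split; lia.
Qed.

End LocalRatio.

(** * Evaluation with time bounds *)

Section Evaluation.
Variable P : program.
Implicit Types (env : seq value) (e : expr) (u v : value) (T : nat).

(** Only an upper bound on time is recorded, so that bounds can be rounded up while composing. *)
Definition evals env e v T := exists2 t, eval P env e v t & t <= T.

Definition computes f u v T :=
  exists2 body, onth P f = Some body & evals [:: u] body v T.

(** Mirrors the test of [If]: pairs, hence nonempty lists, count as true. *)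
Definition truthy v := if v is VNum 0 then false else true.

Lemma evals_var env i v : onth env i = Some v -> evals env (Var i) v 1.
Proof. by move=> h; exists 1 => //; constructor. Qed.

Lemma evals_const env k : evals env (Const k) (VNum k) 1.
Proof. by exists 1 => //; constructor. Qed.

Lemma evals_add env e1 e2 a b T1 T2 :
  evals env e1 (VNum a) T1 -> evals env e2 (VNum b) T2 ->
  evals env (Add e1 e2) (VNum (a + b)) (T1 + T2).+1.
Proof. by move=> [t1 h1 l1] [t2 h2 l2]; exists (t1 + t2).+1; [constructor|lia]. Qed.

Lemma evals_sub env e1 e2 a b T1 T2 :
  evals env e1 (VNum a) T1 -> evals env e2 (VNum b) T2 ->
  evals env (Sub e1 e2) (VNum (a - b)) (T1 + T2).+1.
Proof. by move=> [t1 h1 l1] [t2 h2 l2]; exists (t1 + t2).+1; [constructor|lia]. Qed.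

Lemma evals_pair env e1 e2 v1 v2 T1 T2 :
  evals env e1 v1 T1 -> evals env e2 v2 T2 ->
  evals env (Pair e1 e2) (VPair v1 v2) (T1 + T2).+1.
Proof. by move=> [t1 h1 l1] [t2 h2 l2]; exists (t1 + t2).+1; [constructor|lia]. Qed.

Lemma evals_fst env e v1 v2 T :
  evals env e (VPair v1 v2) T -> evals env (Fst e) v1 T.+1.
Proof. by move=> [t h l]; exists t.+1; [apply: EvFst h|]. Qed.

Lemma evals_snd env e v1 v2 T :
  evals env e (VPair v1 v2) T -> evals env (Snd e) v2 T.+1.
Proof. by move=> [t h l]; exists t.+1; [apply: EvSnd h|]. Qed.

Lemma evals_if env e e1 e2 u v T1 T2 :
  evals env e u T1 -> evals env (if truthy u then e1 else e2) v T2 ->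
  evals env (If e e1 e2) v (T1 + T2).+1.
Proof.
move=> [t1 h1 l1] [t2 h2 l2]; exists (t1 + t2).+1; last by lia.
case: u h1 h2 => [[|k]|v1 v2] /= h1 h2; [exact: EvIfFalse h1 h2| |];
  exact: EvIfTrue h1 _ h2.
Qed.

Lemma evals_let env e1 e2 u v T1 T2 :
  evals env e1 u T1 -> evals (u :: env) e2 v T2 ->
  evals env (Let e1 e2) v (T1 + T2).+1.
Proof.
by move=> [t1 h1 l1] [t2 h2 l2]; exists (t1 + t2).+1; [apply: EvLet h1 h2|lia].
Qed.

Lemma evals_call env f e u v T1 T2 :
  evals env e u T1 -> computes f u v T2 ->
  evals env (Call f e) v (T1 + T2).+1.
Proof.
move=> [t1 h1 l1] [b hb [t2 h2 l2]].
by exists (t1 + t2).+1; [apply: EvCall h1 hb h2|lia].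
Qed.

Lemma evals_call_arg f u v T :
  computes f u v T -> evals [:: u] (Call f (Var 0)) v T.+2.
Proof. by move=> h; apply: (evals_call (T1 := 1)) h; apply: evals_var. Qed.

Lemma computesI f body u v v' T T' :
  onth P f = Some body -> evals [:: u] body v' T' -> v' = v -> T' <= T ->
  computes f u v T.
Proof.
move=> hb [t ht tT'] <- lT; exists body => //; exists t => //.
exact: leq_trans lT.
Qed.

End Evaluation.

(** * The code of the algorithm *)

Definition Wt e := Fst (Snd e).
Definition SetWt e e' := Pair (Fst e) (Pair e' (Snd (Snd e))).

Local Notation v0 := (Var 0) (only parsing).
Local Notation v1 := (Var 1) (only parsing).
Local Notation v2 := (Var 2) (only parsing).
Local Notation v3 := (Var 3) (only parsing).
Local Notation v4 := (Var 4) (only parsing).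

Local Notation f_main := 0 (only parsing).
Local Notation f_nth := 1 (only parsing).
Local Notation f_adj := 2 (only parsing).
Local Notation f_nz := 3 (only parsing).
Local Notation f_minw := 4 (only parsing).
Local Notation f_sub := 5 (only parsing).
Local Notation f_inn := 6 (only parsing).
Local Notation f_outn := 7 (only parsing).
Local Notation f_relax := 8 (only parsing).
Local Notation f_cross := 9 (only parsing).
Local Notation f_size := 10 (only parsing).
Local Notation f_total := 11 (only parsing).
Local Notation f_cat := 12 (only parsing).
Local Notation f_excess := 13 (only parsing).
Local Notation f_solve := 14 (only parsing).
Local Notation f_pivots := 15 (only parsing).
Local Notation f_pivot := 16 (only parsing).
Local Notation f_mem := 17 (only parsing).
Local Notation f_compl := 18 (only parsing).
Local Notation f_build := 19 (only parsing).

(* A function of several arguments takes nested pairs (a, (b, ...)). A vertex is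
   represented by (rank, (weight, adjacency row)), so that arcs are tested
   without access to the whole matrix. *)
Definition main_body :=
  Let (Call f_build (Pair (Const 0) v0)) (Call f_compl (Pair v0 (Call f_solve v0))).

Definition nth_body :=
  If (Snd v0) (Call f_nth (Pair (Snd (Fst v0)) (Sub (Snd v0) (Const 1))))
    (Fst (Fst v0)).

Definition adj_body := Call f_nth (Pair (Snd (Snd (Fst v0))) (Fst (Snd v0))).

Definition nz_body :=
  If v0
    (Let (Call f_nz (Snd v0)) (If (Wt (Fst v1)) (Pair (Fst v1) v0) v0))
    (Const 0).

(** [a - (a - b)] is the minimum of [a] and [b] under truncated subtraction. *)
Definition minw_body :=
  If (Snd v0)
    (Call f_minw (Pair (Sub (Fst v0) (Sub (Fst v0) (Wt (Fst (Snd v0)))))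
                       (Snd (Snd v0))))
    (Fst v0).

Definition sub_body :=
  If (Snd v0)
    (Pair (SetWt (Fst (Snd v0)) (Sub (Wt (Fst (Snd v0))) (Fst v0)))
          (Call f_sub (Pair (Fst v0) (Snd (Snd v0)))))
    (Const 0).

Definition inn_body :=
  If (Snd v0)
    (Let (Call f_inn (Pair (Fst v0) (Snd (Snd v0))))
      (If (Call f_adj (Pair (Fst (Snd v1)) (Fst v1)))
        (Pair (Fst (Snd v1)) v0) v0))
    (Const 0).

Definition outn_body :=
  If (Snd v0)
    (Let (Call f_outn (Pair (Fst v0) (Snd (Snd v0))))
      (If (Call f_adj (Pair (Fst v1) (Fst (Snd v1))))
        (Pair (Fst (Snd v1)) v0) v0))
    (Const 0).

Definition relax_body :=
  If (Snd v0)
    (If (Call f_adj (Pair (Fst v0) (Fst (Snd v0))))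
      (Let (Call f_relax
             (Pair (SetWt (Fst v0) (Sub (Wt (Fst v0)) (Wt (Fst (Snd v0)))))
                   (Snd (Snd v0))))
        (Pair (Fst v0)
          (Pair (SetWt (Fst (Snd v1)) (Sub (Wt (Fst (Snd v1))) (Wt (Fst v1))))
                (Snd v0))))
      (Let (Call f_relax (Pair (Fst v0) (Snd (Snd v0))))
        (Pair (Fst v0) (Pair (Fst (Snd v1)) (Snd v0)))))
    (Pair (Fst v0) (Const 0)).

Definition cross_body :=
  If (Fst v0)
    (Let (Call f_relax (Pair (Fst (Fst v0)) (Snd v0)))
      (Let (Call f_cross (Pair (Snd (Fst v1)) (Snd v0)))
        (Pair (Pair (Fst v1) (Fst v0)) (Snd v0))))
    (Pair (Const 0) (Snd v0)).

Definition size_body := If v0 (Add (Const 1) (Call f_size (Snd v0))) (Const 0).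

Definition total_body :=
  If v0 (Add (Wt (Fst v0)) (Call f_total (Snd v0))) (Const 0).

Definition cat_body :=
  If (Fst v0)
    (Pair (Fst (Fst v0)) (Call f_cat (Pair (Snd (Fst v0)) (Snd v0))))
    (Snd v0).

(** Computes [4 * a - 3 * b] for the two lengths; it is 0 exactly when the first list has at most
    3/4 of the length of the second. *)
Definition excess_body :=
  Let (Call f_size (Fst v0))
    (Let (Call f_size (Snd v1))
      (Sub (Add (Add v1 v1) (Add v1 v1)) (Add v0 (Add v0 v0)))).

(** The result of the uniform step is the first candidate; the pivots then compete with it. *)
Definition solve_body :=
  Let (Call f_nz v0)
    (If v0
      (Call f_pivots (Pair v0 (Pair v0
        (Call f_solve
          (Call f_sub (Pair (Call f_minw (Pair (Wt (Fst v0)) (Snd v0))) v0))))))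
      (Const 0)).

Definition pivots_body :=
  If (Fst v0)
    (Call f_pivots (Pair (Snd (Fst v0))
      (Pair (Fst (Snd v0)) (Call f_pivot (Pair (Fst (Fst v0)) (Snd v0))))))
    (Snd (Snd v0)).

Definition pivot_body :=
  Let (Call f_inn (Pair (Fst v0) (Fst (Snd v0))))
    (Let (Call f_outn (Pair (Fst v1) (Fst (Snd v1))))
      (If (Add (Call f_excess (Pair v1 (Fst (Snd v2))))
               (Call f_excess (Pair v0 (Fst (Snd v2)))))
        (Snd (Snd v2))
        (Let (Call f_cross (Pair v0 v1))
          (Let (Call f_cat (Pair (Call f_solve (Snd v0))
                                 (Pair (Fst v3) (Call f_solve (Fst v0)))))
            (If (Sub (Call f_total v0) (Call f_total (Snd (Snd v4))))
              v0 (Snd (Snd v4))))))).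

(** Ranks are equal exactly when the two opposite truncated differences sum to 0. *)
Definition mem_body :=
  If (Snd v0)
    (If (Add (Sub (Fst v0) (Fst (Fst (Snd v0)))) (Sub (Fst (Fst (Snd v0))) (Fst v0)))
      (Call f_mem (Pair (Fst v0) (Snd (Snd v0)))) (Const 1))
    (Const 0).

Definition compl_body :=
  If (Fst v0)
    (Pair (Sub (Const 1) (Call f_mem (Pair (Fst (Fst (Fst v0))) (Snd v0))))
          (Call f_compl (Pair (Snd (Fst v0)) (Snd v0))))
    (Const 0).

Definition build_body :=
  If (Fst (Snd v0))
    (Pair (Pair (Fst v0) (Pair (Fst (Snd (Snd v0))) (Fst (Fst (Snd v0)))))
          (Call f_build (Pair (Add (Fst v0) (Const 1))
                              (Pair (Snd (Fst (Snd v0))) (Snd (Snd (Snd v0)))))))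
    (Const 0).

Definition fvst : program :=
  [:: main_body; nth_body; adj_body; nz_body; minw_body; sub_body; inn_body;
      outn_body; relax_body; cross_body; size_body; total_body; cat_body;
      excess_body; solve_body; pivots_body; pivot_body; mem_body; compl_body;
      build_body].

(* Automated evaluation of programs *)
Create HintDb comp.

Ltac branch :=
  match goal with
  | H : truthy ?u = _ |- evals _ _ (if truthy ?u then _ else _) _ _ =>
      rewrite H; cbv iota beta delta [negb]
  | |- evals _ _ (if ?b then _ else _) _ _ =>
      let b' := eval hnf in b in change b with b'; cbv iota
  end.

(** Syntax-directed: the time bound is an existential variable filled in along the way, and calls
    are closed by hypotheses or by the [comp] hints. *)
Ltac ev :=
  lazymatch goal with
  | |- evals _ _ (Var _) _ _ => eapply evals_var; reflexivity
  | |- evals _ _ (Const _) _ _ => eapply evals_const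
  | |- evals _ _ (Add _ _) _ _ => eapply evals_add; [ev | ev]
  | |- evals _ _ (Sub _ _) _ _ => eapply evals_sub; [ev | ev]
  | |- evals _ _ (Pair _ _) _ _ => eapply evals_pair; [ev | ev]
  | |- evals _ _ (Fst _) _ _ => eapply evals_fst; ev
  | |- evals _ _ (Snd _) _ _ => eapply evals_snd; ev
  | |- evals _ _ (Wt _) _ _ => unfold Wt; ev
  | |- evals _ _ (SetWt _ _) _ _ => unfold SetWt; ev
  | |- evals _ _ (If _ _ _) _ _ => eapply evals_if; [ev | branch; ev]
  | |- evals _ _ (Let _ _) _ _ => eapply evals_let; [ev | ev]
  | |- evals _ _ (Call _ _) _ _ => eapply evals_call; [ev | ev]
  | |- evals _ _ ?body _ _ => unfold body; ev
  | |- computes _ ?f _ _ _ =>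
      first [ match goal with H : _ |- _ => eapply H end
            | solve [eauto 2 with comp] | idtac ]
  | |- _ => idtac
  end.

Ltac run := eapply computesI; [reflexivity | ev | .. ].

Lemma computes_le P f u v T T' : T <= T' -> computes P f u v T -> computes P f u v T'.
Proof.
by move=> lT [b hb [t ht lt]]; exists b => //; exists t => //; apply: leq_trans lT.
Qed.

(** * The program and its running time *)

Section Program.
Variables (V : finType) (G : rel V).
Variables (n : nat) (cardV : #|V| = n).
Notation item := (V * nat)%type.
Implicit Types (x y p : item) (s u K : seq item).

Definition rank (a : V) : nat := enum_rank a.

Definition enc_row a := encode_seq [seq VNum (G a b) | b <- enum V].
Definition enc_item x := VPair (VNum (rank x.1)) (VPair (VNum x.2) (enc_row x.1)).
Definition enc s := encode_seq [seq enc_item x | x <- s].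

Notation computes := (computes fvst).

Lemma ltn_rank a : rank a < n.
Proof. by rewrite -cardV ltn_ord. Qed.

Lemma comp_nth (l : seq value) i :
  i < size l ->
  computes f_nth (VPair (encode_seq l) (VNum i)) (nth (VNum 0) l i) (20 * i.+1).
Proof.
elim: i l => [|i IH] [|v l] //= lt_i; first by run => //; lia.
have {}IH := IH l lt_i; run; [rewrite subn1 /=; exact: IH | by [] | lia].
Qed.

Lemma comp_adj x y :
  computes f_adj (VPair (enc_item x) (enc_item y)) (VNum (G x.1 y.1)) (20 * n + 30).
Proof.
have := @comp_nth [seq VNum (G x.1 b) | b <- enum V] (rank y.1).
rewrite size_map -cardE cardV ltn_rank => /(_ isT) h; run.
- by rewrite (nth_map y.1) -?cardE ?cardV ?ltn_rank // nth_enum_rank.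
- by have := ltn_rank y.1; lia.
Qed.

Hint Extern 1 (computes f_adj _ _ _) => eapply comp_adj : comp.

Lemma comp_nz s : computes f_nz (enc s) (enc (nz s)) (30 * (size s).+1).
Proof.
elim: s => [|[a [|k]] s IH] /=; run => //=; lia.
Qed.

Lemma comp_minw m s :
  computes f_minw (VPair (VNum m) (enc s)) (VNum (minw m s)) (30 * (size s).+1).
Proof.
elim: s m => [|x s IH] m /=; first by run => //; lia.
run; [by rewrite minnE | lia].
Qed.

Lemma comp_lower m s :
  computes f_sub (VPair (VNum m) (enc s)) (enc (lower m s)) (50 * (size s).+1).
Proof. elim: s => [|x s IH] /=; run => //; lia. Qed.

Lemma comp_inn p s :
  computes f_inn (VPair (enc_item p) (enc s)) (enc (inn G p s))
    ((20 * n + 100) * (size s).+1).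
Proof.
elim: s => [|x s IH] /=; first by run => //; lia.
have := comp_adj x p; case: (G x.1 p.1) => h; run => //=; lia.
Qed.

Lemma comp_outn p s :
  computes f_outn (VPair (enc_item p) (enc s)) (enc (outn G p s))
    ((20 * n + 100) * (size s).+1).
Proof.
elim: s => [|x s IH] /=; first by run => //; lia.
have := comp_adj p x; case: (G p.1 x.1) => h; run => //=; lia.
Qed.

Lemma comp_relax x s :
  computes f_relax (VPair (enc_item x) (enc s))
    (VPair (enc_item (relax G x s).1) (enc (relax G x s).2))
    ((20 * n + 200) * (size s).+1).
Proof.
elim: s x => [|y s IH] x /=; first by run => //; lia.
have := comp_adj x y; case: (G x.1 y.1) => h.
  by have {}IH := IH (x.1, x.2 - y.2); run => //=; lia.
by have {}IH := IH x; run => //=; lia.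
Qed.

Lemma comp_cross s u :
  computes f_cross (VPair (enc s) (enc u))
    (VPair (enc (cross G s u).1) (enc (cross G s u).2))
    ((20 * n + 300) * (size u).+1 * (size s).+1).
Proof.
elim: s u => [|x s IH] u /=; first by run => //; lia.
have h := comp_relax x u; have {}IH := IH (relax G x u).2.
run => //=.
have [_ _ e _ _] := relax_spec G x u.
(* Relaxing keeps the length, so every round has the same bound. *)
have -> : size (relax G x u).2 = size u.
  by rewrite -(size_map fst) -[map _ _]/(unzip1 _) e size_map.
lia.
Qed.

Lemma comp_size s : computes f_size (enc s) (VNum (size s)) (20 * (size s).+1).
Proof. elim: s => [|x s IH] /=; run => //; lia. Qed.

Lemma comp_total s :
  computes f_total (enc s) (VNum (total_weight s)) (20 * (size s).+1).
Proof.
elim: s => [|x s IH] /=; run; rewrite ?total_weight_cons //; try lia.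
by rewrite /total_weight big_nil.
Qed.

Lemma comp_cat s u :
  computes f_cat (VPair (enc s) (enc u)) (enc (s ++ u)) (20 * (size s).+1).
Proof. elim: s => [|x s IH] /=; run => //; lia. Qed.

Lemma comp_excess s u :
  computes f_excess (VPair (enc s) (enc u)) (VNum (4 * size s - 3 * size u))
    (20 * (size s + size u) + 100).
Proof.
have h1 := comp_size s; have h2 := comp_size u; run; [congr VNum|]; lia.
Qed.

Lemma comp_mem (a : V) K :
  computes f_mem (VPair (VNum (rank a)) (enc K)) (VNum (a \in unzip1 K))
    (50 * (size K).+1).
Proof.
elim: K => [|x K IH] /=; first by run => //; lia.
rewrite inE.
have : truthy (VNum (rank a - rank x.1 + (rank x.1 - rank a))) = (a != x.1).
  rewrite -(inj_eq enum_rank_inj) -val_eqE /= eqn_leq -!subn_eq0 -addn_eq0.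
  by case: (_ + _).
case: (a == x.1) => e; run => //; lia.
Qed.

Lemma comp_compl s K :
  computes f_compl (VPair (enc s) (enc K))
    (encode_seq [seq VNum (x.1 \notin unzip1 K) | x <- s])
    ((50 * size K + 100) * (size s).+1).
Proof.
elim: s => [|x s IH] /=; first by run => //; lia.
have h := comp_mem x.1 K; run; last by lia.
by case: (x.1 \in _).
Qed.

(** The program uses a counter as rank, which is right when the ranks along [l] are consecutive from
    [i]. *)
Lemma comp_build (w : V -> nat) (l : seq V) i :
  [seq rank a | a <- l] = iota i (size l) ->
  computes f_build
    (VPair (VNum i) (VPair (encode_seq [seq enc_row a | a <- l])
                           (encode_seq [seq VNum (w a) | a <- l])))
    (enc [seq (a, w a) | a <- l]) (50 * (size l).+1).
Proof.
elim: l i => [|a l IH] i /=; first by move=> _; run => //; lia.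
case=> <- /IH{}IH; run; [by rewrite addn1; exact: IH| by [] | lia].
Qed.

(** * Analysis of the recursion *)

Hypothesis Gt : tournament G.
Notation N := n.+1.

Lemma uniq_size s : uniq (unzip1 s) -> size s <= n.
Proof.
move=> us; rewrite -(size_map fst) -(card_uniqP us) -cardV.
exact: max_card.
Qed.

(** The value of the candidate never decreases, so guarantees won by earlier candidates persist. The
    term [2 * F] pays for the two recursive calls. *)
Lemma pivot_run M F p u best :
  N * N * N <= M ->
  uniq (unzip1 u) -> p \in u -> forward G best -> below best u ->
  (forall s, uniq (unzip1 s) -> 4 * size s <= 3 * size u ->
    exists2 K, solution G s K & computes f_solve (enc s) (enc K) F) ->
  exists K, [/\
    computes f_pivot (VPair (enc_item p) (VPair (enc u) (enc best))) (enc K)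
      (2 * F + 3000 * M),
    forward G K, below K u, total_weight best <= total_weight K
    & balanced G p u ->
      forall S, hits_triangles G S -> p.1 \notin S -> covers u K S].
Proof.
move=> lM uu pu fb bb hsolve.
have su := uniq_size uu.
have lN2 : N * N <= M by apply: leq_trans lM; rewrite leq_pmulr.
have lN1 : N <= M by apply: leq_trans lN2; rewrite leq_pmulr.
have si : size (inn G p u) <= n by rewrite (leq_trans _ su) // size_filter count_size.
have so : size (outn G p u) <= n by rewrite (leq_trans _ su) // size_filter count_size.
have h1 : computes f_inn (VPair (enc_item p) (enc u)) (enc (inn G p u)) (100 * M).
  by apply: computes_le (comp_inn p u); nia.
have h2 : computes f_outn (VPair (enc_item p) (enc u)) (enc (outn G p u)) (100 * M).
  by apply: computes_le (comp_outn p u); nia.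
have h3 : computes f_excess (VPair (enc (inn G p u)) (enc u))
    (VNum (4 * size (inn G p u) - 3 * size u)) (100 * M).
  by apply: computes_le (comp_excess _ _); lia.
have h4 : computes f_excess (VPair (enc (outn G p u)) (enc u))
    (VNum (4 * size (outn G p u) - 3 * size u)) (100 * M).
  by apply: computes_le (comp_excess _ _); lia.
have htr : truthy (VNum (4 * size (inn G p u) - 3 * size u
                         + (4 * size (outn G p u) - 3 * size u))) = ~~ balanced G p u.
  by rewrite /balanced -!subn_eq0 -addn_eq0; case: (_ + _).
case bal: (balanced G p u) htr => htr; last first.
  by exists best; split=> //; run => //; lia.
have [c1 c2 c3 c4 _] := cross_spec G (outn G p u) (inn G p u).
set c := cross G _ _ in c1 c2 c3 c4.
have subu a : uniq (unzip1 [seq x <- u | a x]).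
  by apply: subseq_uniq uu; exact/map_subseq/filter_subseq.
have h5 : computes f_cross (VPair (enc (outn G p u)) (enc (inn G p u)))
    (VPair (enc c.1) (enc c.2)) (300 * M).
  apply: computes_le (comp_cross _ _).
  apply: (@leq_trans (300 * N * N * N)); last by lia.
  by rewrite !leq_mul //; lia.
have zo : size c.1 = size (outn G p u).
  by rewrite -(size_map fst) -[map _ _]/(unzip1 _) c1 size_map.
have zi : size c.2 = size (inn G p u).
  by rewrite -(size_map fst) -[map _ _]/(unzip1 _) c2 size_map.
have /andP[bi bo] := bal.
have [K1 s1 h6] : exists2 K, solution G c.2 K & computes f_solve (enc c.2) (enc K) F.
  by apply: hsolve; [rewrite c2; exact: subu | rewrite zi].
have [K2 s2 h7] : exists2 K, solution G c.1 K & computes f_solve (enc c.1) (enc K) F.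
  by apply: hsolve; [rewrite c1; exact: subu | rewrite zo].
have [fK bK] := pivot_forward Gt pu s1 s2.
have cov S hS pS : covers u (K1 ++ p :: K2) S := pivot_covers Gt uu pu hS pS s1 s2.
have sK : size (K1 ++ p :: K2) <= n by apply: uniq_size; case/andP: fK.
have sb : size best <= n by apply: uniq_size; case/andP: fb.
have h8 : computes f_cat (VPair (enc K1) (enc (p :: K2)))
    (enc (K1 ++ p :: K2)) (100 * M).
  by apply: computes_le (comp_cat _ _); move: sK; rewrite size_cat; lia.
have h9 : computes f_total (enc (K1 ++ p :: K2))
    (VNum (total_weight (K1 ++ p :: K2))) (100 * M).
  by apply: computes_le (comp_total _); lia.
have h10 : computes f_total (enc best) (VNum (total_weight best)) (100 * M).
  by apply: computes_le (comp_total _); lia.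
set K := K1 ++ p :: K2 in fK bK cov sK h8 h9 h10.
have htr2 : truthy (VNum (total_weight K - total_weight best))
    = ~~ (total_weight K <= total_weight best).
  by rewrite -subn_eq0; case: (_ - _).
case: leqP htr2 => lK htr2.
  (* The old candidate has at least the value of [K] and so inherits its guarantee. *)
  exists best; split=> //; first by run => //; lia.
  by move=> _ S hS pS; rewrite /covers (leq_trans (cov S hS pS)) // leq_add2r.
by exists K; split=> //; [run => //; lia | exact: ltnW].
Qed.

(** By monotonicity of the value, one list [K] serves all sets [S] and all balanced pivots outside
    them at once. *)
Lemma pivots_run M F u rest best :
  N * N * N <= M ->
  uniq (unzip1 u) -> {subset rest <= u} -> forward G best -> below best u ->
  (forall s, uniq (unzip1 s) -> 4 * size s <= 3 * size u ->
    exists2 K, solution G s K & computes f_solve (enc s) (enc K) F) ->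
  exists K, [/\
    computes f_pivots (VPair (enc rest) (VPair (enc u) (enc best))) (enc K)
      ((2 * F + 4000 * M) * (size rest).+1),
    forward G K, below K u, total_weight best <= total_weight K
    & forall p, p \in rest -> balanced G p u ->
      forall S, hits_triangles G S -> p.1 \notin S -> covers u K S].
Proof.
move=> lM uu + + + hsolve.
have lN : 0 < M by apply: leq_trans lM.
elim: rest best => [|p rest IH] best sub fb bb.
  by exists best; split=> //; run => //; lia.
have pu : p \in u by apply: sub; rewrite mem_head.
have [K [h1 fK bK lK cK]] := pivot_run lM uu pu fb bb hsolve.
have [|K' [h2 fK' bK' lK' cK']] := IH K _ fK bK.
  by move=> x xr; apply: sub; rewrite inE xr orbT.
exists K'; split=> //; [by run => //=; lia | exact: leq_trans lK'|].
move=> q; rewrite inE => /predU1P[->|qr]; last exact: cK'.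
move=> bal S hS pS.
by rewrite /covers (leq_trans (cK bal S hS pS)) // leq_add2r.
Qed.

(* d bounds the nesting of pivots, since a pivot step leaves at most 3/4 of the
   vertices. *)
Lemma solve_run M B d s :
  N * N * N <= M -> 20 * 1000 * N * N * M <= B ->
  uniq (unzip1 s) -> size (nz s) * 3 ^ d < 4 ^ d ->
  exists2 K, solution G s K &
    computes f_solve (enc s) (enc K) (B ^ d.+1).
Proof.
move=> lM lB; have M0 : 0 < M by apply: leq_trans lM.
have lBN : 1000 * N <= B by apply: leq_trans lB; nia.
have B0 : 0 < B by apply: leq_trans lB; rewrite !muln_gt0.
elim: d s => [|d IHd] s us.
  (* At depth 0 no vertex of positive weight is left. *)
  rewrite muln1 ltnS leqn0 => /nilP s0.
  exists [::]; first exact: solution_nil.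
  have h := comp_nz s; rewrite s0 in h; have := uniq_size us.
  by rewrite expn1 => sn; run => //; lia.
move=> hs.
set F := B ^ d.+1 in IHd.
have F0 : 0 < F by rewrite expn_gt0 B0.
have [C eC] : exists C, C = N * (2 * F + 4000 * M) + 1000 * N by eexists.
have lC : 1000 * N <= C by rewrite eC leq_addl.
(* The uniform step keeps [d] but removes a positive weight, hence an inner induction on their
   number [m]; [C] is the cost of one level, with the loop over all pivots. *)
suff /(_ (size (nz s)) s us (leqnn _) hs)[K sK cK] : forall m s, uniq (unzip1 s) ->
    size (nz s) <= m -> size (nz s) * 3 ^ d.+1 < 4 ^ d.+1 ->
    exists2 K, solution G s K & computes f_solve (enc s) (enc K)
      (C * m.+1).
  exists K => //; apply: computes_le cK.
  have : size (nz s) <= n.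
    by rewrite (leq_trans _ (uniq_size us)) // size_filter count_size.
  rewrite expnS -/F => sn.
  apply: (@leq_trans (C * N)).
    by rewrite leq_mul2l ltnS sn orbT.
  apply: (@leq_trans (20 * 1000 * N * N * M * F)); last by rewrite leq_mul2r lB orbT.
  have -> : C * N = N * N * (2 * F + 4000 * M + 1000) by rewrite eC; lia.
  have -> : 20 * 1000 * N * N * M * F = N * N * (20 * 1000 * (M * F)) by lia.
  by rewrite leq_mul2l; nia.
elim=> [|m IHm] {}s {}us sm {}hs.
  move: sm; rewrite leqn0 => /nilP s0.
  exists [::]; first exact: solution_nil.
  have h := comp_nz s; rewrite s0 in h; have := uniq_size us => sn.
  by run => //; lia.
have [s0|] := eqVneq (nz s) [::].
  have [|K sK cK] := IHm s us _ hs; first by rewrite s0.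
  by exists K => //; apply: computes_le cK; rewrite leq_mul2l leqnSn orbT.
case E: (nz s) => [|x u'] // _.
have uu : uniq (unzip1 (nz s)).
  by apply: subseq_uniq us; exact/map_subseq/filter_subseq.
pose mw := minw x.2 u'.
have mw_le : forall y, y \in nz s -> mw <= y.2.
  by rewrite E => y; have [h1 h2] := minw_le x.2 u'; rewrite inE => /predU1P[->//|/h2].
have mw_mem : exists2 y, y \in nz s & mw = y.2.
  rewrite E /mw; case: (minw_mem x.2 u') => [->|[y yu ->]].
    by exists x; rewrite ?mem_head.
  by exists y; rewrite // inE yu orbT.
have low_uniq : uniq (unzip1 (lower mw (nz s))) by rewrite /unzip1 -map_comp.
have lt_low := nz_lower_lt mw_mem.
have [||K0 sK0 cK0] := IHm _ low_uniq; first by rewrite -ltnS (leq_trans lt_low).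
  by apply: leq_ltn_trans hs; rewrite leq_mul2r (ltnW lt_low) orbT.
have [f0 b0 c0] := sK0.
have bK0 : below K0 (nz s).
  apply: (@below_trans _ (lower mw (nz s))); last exact: below_lower.
  by apply: (below_trans b0); apply: sub_below => y; apply: nz_sub.
have sn := uniq_size us.
have szn : size (nz s) <= n by rewrite (leq_trans _ sn) // size_filter count_size.
(* Shrinking to 3/4 of the size pays for one unit of depth. *)
have hsolve t : uniq (unzip1 t) -> 4 * size t <= 3 * size (nz s) ->
    exists2 K, solution G t K & computes f_solve (enc t) (enc K) F.
  move=> ut st; apply: IHd => //.
  have : size (nz t) <= size t by rewrite size_filter count_size.
  by move: hs; rewrite !expnS; nia.
have [K [h fK bK lK cK]] := pivots_run lM uu (fun _ => id) f0 bK0 hsolve.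
exists K.
  apply: solution_nz; split; rewrite ?nz_id // => S hS.
  (* If [S] is large, the uniform candidate covers it and [K] has at least its value; otherwise some
     balanced pivot avoids [S]. *)
  have [hc|hc] := leqP (size (nz s)) (2 * count (fun y => y.1 \in S) (nz s)).
    have := lower_covers mw_le hc (c0 S hS); rewrite /covers => /leq_trans; apply.
    by rewrite leq_add2r.
  have [p [pu pS bal]] := balanced_pivot Gt uu hS hc.
  exact: cK pu bal S hS pS.
have h1 := comp_nz s.
have h2 := comp_minw x.2 u'; rewrite -/mw in h2.
have h3 := comp_lower mw (nz s).
rewrite E in h h1 h3 cK0 szn.
have lC' : (2 * F + 4000 * M) * (size (x :: u')).+1 + 1000 * N <= C.
  by rewrite eC leq_add2r mulnC leq_mul2r ltnS szn orbT.
by rewrite /= in szn lC'; run => //=; lia.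
Qed.

Lemma main_run M B d (w : V -> nat) rows :
  rows = encode_seq [seq enc_row a | a <- enum V] ->
  N * N * N <= M -> 20 * 1000 * N * N * M <= B -> n * 3 ^ d < 4 ^ d ->
  exists2 K, solution G [seq (a, w a) | a <- enum V] K &
    evals fvst [:: VPair rows (encode_seq [seq VNum (w a) | a <- enum V])]
      (Call f_main v0)
      (encode_seq [seq VNum (a \notin unzip1 K) | a <- enum V]) (B ^ d.+1 + B).
Proof.
move=> -> lM lB ld; set s := [seq (a, w a) | a <- enum V].
have us : uniq (unzip1 s) by rewrite /unzip1 -map_comp map_id enum_uniq.
have ss : size s = n by rewrite size_map -cardE.
have [|K sK cK] := @solve_run M B d s lM lB us.
  by apply: leq_ltn_trans ld; rewrite leq_mul2r -ss size_filter count_size orbT.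
exists K => //.
(* The enumeration lists the vertices by rank, as the counter of [f_build] assumes. *)
have eV : [seq rank a | a <- enum V] = iota 0 (size (enum V)).
  apply: (@eq_from_nth _ 0) => [|i]; rewrite size_map ?size_iota // => iV.
  have x0 : V by case: (enum V) iV => // a.
  rewrite (nth_map x0) // nth_iota // /rank add0n.
  have iV' : i < #|V| by rewrite cardE.
  by rewrite -(enum_val_nth x0 (Ordinal iV')) enum_valK.
have h1 := @comp_build w (enum V) 0 eV.
have h2 := comp_compl s K.
have fK : size K <= n by apply: uniq_size; case: sK => /andP[].
have N2 : (50 * size K + 100) * N <= 200 * N * N by nia.
have lB' : 1000 * N * N <= B by apply: leq_trans lB; nia.
have e : [seq VNum (x.1 \notin unzip1 K) | x <- s]
    = [seq VNum (a \notin unzip1 K) | a <- enum V].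
  by rewrite -map_comp.
have sV : size (enum V) = n by rewrite -cardE.
rewrite e -/s ss in h2; rewrite -/s sV in h1.
have hm : computes f_main
    (VPair (encode_seq [seq enc_row a | a <- enum V])
           (encode_seq [seq VNum (w a) | a <- enum V]))
    (encode_seq [seq VNum (a \notin unzip1 K) | a <- enum V])
    (B ^ d.+1 + 500 * N * N).
  run => //; nia.
have [t ht lt] := evals_call_arg hm.
by exists t => //; apply: leq_trans lt _; nia.
Qed.

End Program.

(** * From solutions to feedback vertex sets *)

(** Every remaining arc strictly increases the position in [K], which is impossible around a
    cycle. *)
Lemma forward_acyclic (V : finType) (G : rel V) (K : seq (V * nat)) :
  irreflexive G -> forward G K ->
  acyclic (del_vertices G (~: [set a in unzip1 K])).
Proof.
move=> irr /andP[_ fK] [//|a c] _ /andP[+ _].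
set L := unzip1 K; set e := del_vertices _ _.
have fL : pairwise (fun b c => ~~ G c b) L by rewrite pairwise_map.
pose lt b c := index b L < index c L.
have lt_tr : transitive lt by move=> x y z; apply: ltn_trans.
have e_lt : subrel e lt.
  move=> x y; rewrite /e /del_vertices !inE !negbK /lt => /and3P[xL yL xy].
  rewrite ltnNge leq_eqVlt; apply/negP => /orP[/eqP exy|yx].
    by move: xy; rewrite -(nth_index x xL) -exy nth_index // irr.
  have /(pairwiseP x)/(_ _ _ _ _ yx) := fL.
  by rewrite !inE !index_mem !nth_index // xy => /(_ yL xL).
move=> /(sub_cycle e_lt) /= /(order_path_min lt_tr).
by rewrite all_rcons /lt ltnn.
Qed.

Lemma fvs_hits_triangles (V : finType) (G : rel V) (S : {set V}) :
  irreflexive G -> is_fvs G S -> hits_triangles G S.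
Proof.
move=> irr fS a b c ab bc ca; apply/negPn; rewrite !negb_or.
apply/negP => /and3P[aS bS cS]; apply: (fS [:: a; b; c]) => //.
have neq x y : G x y -> x != y by apply: contraTneq => ->; rewrite irr.
apply/andP; split; first by rewrite /= /del_vertices aS bS cS ab bc ca.
by rewrite /= !inE negb_or (eq_sym a c) !neq.
Qed.

(** The value of [K] is at most the original weight kept; subtracting that weight from both sides of
    [covers] bounds the deleted weight by twice that of [S]. *)
Lemma solution_approx (V : finType) (G : rel V) (w : V -> nat) K :
  tournament G -> solution G [seq (a, w a) | a <- enum V] K ->
  two_approx_fvs G w (~: [set a in unzip1 K]).
Proof.
move=> Gt [fK bK cK]; have irr := Gt.1.
split; first exact: forward_acyclic.
move=> S [/(fvs_hits_triangles irr)/cK cov _]; move: cov.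
have lK : total_weight K <= \sum_(a <- unzip1 K) w a.
  rewrite /total_weight big_map big_seq [leqRHS]big_seq.
  apply: leq_sum => x xK.
  by have [y /nz_sub/mapP[a _ ->] [-> ]] := bK _ xK.
have eK : \sum_(a <- unzip1 K) w a = weight w [set a in unzip1 K].
  rewrite /weight big_uniq; last by case/andP: fK.
  by apply: eq_bigl => a; rewrite inE.
have eS : cost S [seq (a, w a) | a <- enum V] = weight w S.
  by rewrite /cost big_map /= big_enum_cond.
have eT : total_weight [seq (a, w a) | a <- enum V] =
    weight w [set a in unzip1 K] + weight w (~: [set a in unzip1 K]).
  rewrite /total_weight big_map /= big_enum /= (bigID (mem [set a in unzip1 K])) /=.
  by congr (_ + _); apply: eq_bigl => a; rewrite !inE.
rewrite /covers eS eT; lia.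
Qed.

(** * Numerical bounds *)

(* (4/3)^3 > 2. *)
Definition log_bound n := 3 * (trunc_log 2 n).+1.
Definition poly_bound n := 20 * 1000 * n.+1 * n.+1 * (n.+1 * n.+1 * n.+1).

(** With [n < 2 ^ k], it reduces to [2 * 27 <= 64]. *)
Lemma log_boundP n : n * 3 ^ log_bound n < 4 ^ log_bound n.
Proof.
rewrite /log_bound !expnM; set k := (trunc_log 2 n).+1.
have nk : n < 2 ^ k by apply: trunc_log_ltn.
apply: (@leq_trans (2 ^ k * 27 ^ k)); first by rewrite ltn_mul2r nk expn_gt0.
by rewrite -expnMn leq_exp2r.
Qed.

Lemma time_bound :
  n_pow_O_log (fun n => poly_bound n ^ (log_bound n).+1 + poly_bound n).
Proof.
exists 50, 1000 => n n0.
(* From [n.+1 <= 2 * n] the constant becomes [20 * 1000 * 32], below [1000 * 1000], which [n0] makes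
   at most [n * n]. *)
have lB : poly_bound n <= n ^ 7.
  have n2 : n.+1 <= 2 * n by lia.
  have nn : 1000 * 1000 <= n * n by apply: leq_mul.
  apply: (@leq_trans (20 * 1000 * (2 * n) * (2 * n) * ((2 * n) * (2 * n) * (2 * n)))).
    by rewrite /poly_bound !leq_mul.
  have -> : n ^ 7 = n * n * (n * n * n * n * n) by rewrite !expnS expn0; lia.
  apply: (@leq_trans (1000 * 1000 * (n * n * n * n * n))); last first.
    by rewrite leq_mul2r nn orbT.
  lia.
have L1 : 0 < trunc_log 2 n by rewrite trunc_log_gt0; lia.
have n1 : 0 < n by lia.
have lE : poly_bound n ^ (log_bound n).+1 <= n ^ (7 * (log_bound n).+1).
  by rewrite expnM leq_exp2r.
have lE' : poly_bound n <= n ^ (7 * (log_bound n).+1).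
  by apply: leq_trans lB _; rewrite leq_pexp2l //; lia.
apply: (@leq_trans (n ^ (7 * (log_bound n).+1).+1)).
  rewrite expnS (leq_trans (leq_add lE lE')) // addnn -mul2n leq_mul2r orbC.
  by rewrite (leq_trans _ n0).
(* With [L] the logarithm the exponent is [21 * L + 29], at most [50 * L] since [L] is positive. *)
rewrite leq_pexp2l // /log_bound; lia.
Qed.

Theorem theorem2 :
  exists (P : program) (T : nat -> nat),
    n_pow_O_log T /\
    forall (n : nat) (G : rel 'I_n) (w : 'I_n -> nat),
      tournament G ->
      exists (S : {set 'I_n}) (t : nat),
        [/\ runs P (encode_instance G w) (encode_set S) t,
            t <= T n
          & two_approx_fvs G w S].
Proof.
exists fvst, (fun n => poly_bound n ^ (log_bound n).+1 + poly_bound n).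
split; first exact: time_bound.
move=> n G w Gt.
have [K sK [t ht lt]] := @main_run _ G n (card_ord n) Gt _ (poly_bound n) _ w _
  erefl (leqnn _) (leqnn _) (log_boundP n).
exists (~: [set a in unzip1 K]), t; split=> //; last exact: solution_approx.
rewrite /runs /encode_set; under eq_map do rewrite !inE.
exact: ht.
Qed.
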